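(* Let $M$ be a smooth manifold with $\dim M>0$, let $X_0,X_1,\dots,X_m\in\mathfrak X(M)$ be smooth vector fields, and consider the control system $\dot x(t)=X_0(x(t))+\sum_{i=1}^m u_i(t)X_i(x(t))$ on $M$. Then the associated complete lifted control system $$\dot v(t)=X_0^c(v(t))+\sum_{i=1}^m u_i(t)X_i^c(v(t))$$ is not controllable on $TM$.
   Context: $\pi:TM\to M$ is the tangent bundle. For $f\in C^\infty(M)$, its complete lift is $f^c\in C^\infty(TM)$, $f^c(v)=df(v)$. The complete lift of $X\in\mathfrak X(M)$ is the unique vector field $X^c\in\mathfrak X(TM)$ with $X^c(f^c)=(Xf)^c$ for all $f\in C^\infty(M)$; in induced coordinates $(x^i,v^i)$, if $X=X^i\partial_{x^i}$ then $X^c=X^i(x)\frac{\partial}{\partial x^i}+v^j\frac{\partial X^i}{\partial x^j}(x)\frac{\partial}{\partial v^i}$. Admissible controls form a fixed class $\mathcal U$ of locally bounded measurable functions $u:\mathbb R\to U\subset\mathbb R^m$; solutions are absolutely continuous curves satisfying the differential equation for almost every $t$. A control system on a manifold $N$ is controllable on $N$ if for all $p,q\in N$ there exist $t>0$ and an admissible control $u$ such that the solution with control $u$ starting at $p$ at time $0$ is defined up to time $t$ and equals $q$ at time $t$. *)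

(* Defs.v *)
From HB Require Import structures.
From mathcomp Require Import all_boot all_order all_algebra.
From mathcomp Require Import all_classical all_reals all_analysis.
Set Implicit Arguments.
Unset Strict Implicit.
Unset Printing Implicit Defensive.
Import Order.TTheory GRing.Theory Num.Theory.
Import numFieldNormedType.Exports.
Local Open Scope classical_set_scope.
Local Open Scope ring_scope.

(* f is C^k on the open set A; since 'D_v f is linear in v where f is
   differentiable, asking this of all v amounts to asking it of the partial
   derivatives. *)
Fixpoint Ck_on (R : realType) (V W : normedModType R) (k : nat) (A : set V)
    (f : V -> W) : Prop :=
  if k is k'.+1 then
    (forall x, A x -> differentiable f x) /\ (forall v, Ck_on k' A ('D_v f))
  else forall x, A x -> {for x, continuous f}.

Definition smooth_on (R : realType) (V W : normedModType R) (A : set V)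
    (f : V -> W) : Prop := forall k, Ck_on k A f.

(* A nonempty set with charts into R^n; the functions chart_map i are only
   meaningful on chart_dom i. The axioms of a manifold are stated separately,
   in smooth_manifold. *)
Record atlas (R : realType) := Atlas {
  carrier :> Type;
  origin : carrier; (* any point: manifolds are nonempty *)
  mdim : nat;
  chart_index : Type;
  chart_dom : chart_index -> set carrier;
  chart_map : chart_index -> carrier -> 'rV[R]_mdim;
  chart_at : carrier -> chart_index }.

Arguments origin {R} a.
Arguments mdim {R} a.
Arguments chart_index {R} a.
Arguments chart_dom {R a} i.
Arguments chart_map {R a} i.
Arguments chart_at {R a} p.

Section AtlasTopology.
Context {R : realType} (M : atlas R).

Definition atlas_open (O : set M) : Prop :=
  forall i : chart_index M, exists2 V : set 'rV[R]_(mdim M),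
    open V & O `&` chart_dom i = chart_map i @^-1` V `&` chart_dom i.

Lemma atlas_openT : atlas_open setT.
Proof. by move=> i; exists setT; [exact: openT | rewrite preimage_setT]. Qed.

Lemma atlas_openI : setI_closed atlas_open.
Proof.
move=> A B oA oB i; have [V oV AV] := oA i; have [W oW BW] := oB i.
exists (V `&` W); first exact: openI.
by rewrite preimage_setI setIIl AV BW -setIIl.
Qed.

Lemma atlas_open_bigU (I : Type) (f : I -> set M) :
  (forall i, atlas_open (f i)) -> atlas_open (\bigcup_i f i).
Proof.
move=> of_ i.
pose V k := projT1 (cid2 (of_ k i)).
have oV k : open (V k) by rewrite /V; case: cid2.
have fV k : f k `&` chart_dom i = chart_map i @^-1` V k `&` chart_dom i.
  by rewrite /V; case: cid2.
exists (\bigcup_k V k); first by apply: bigcup_open => k _; exact: oV.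
rewrite preimage_bigcup !setI_bigcupl.
by apply: eq_bigcupr => k _; exact: fV.
Qed.

HB.instance Definition _ := gen_eqMixin (carrier M).
HB.instance Definition _ := gen_choiceMixin (carrier M).
HB.instance Definition _ := isPointed.Build (carrier M) (origin M).
HB.instance Definition _ := isOpenTopological.Build (carrier M)
  atlas_openT atlas_openI atlas_open_bigU.

End AtlasTopology.

Section Manifolds.
Context {R : realType}.
Implicit Types M N : atlas R.

Definition chart_inv M (i : chart_index M) : 'rV[R]_(mdim M) -> M :=
  pinv (chart_dom i) (chart_map i).

Definition transition M (i j : chart_index M) :
    'rV[R]_(mdim M) -> 'rV[R]_(mdim M) :=
  chart_map j \o chart_inv i.

Record smooth_manifold M : Prop := SmoothManifold {
  chart_atP : forall p : M, chart_dom (chart_at p) p;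
  chart_map_inj : forall i : chart_index M,
    {in chart_dom i &, injective (chart_map i)};
  chart_overlap_open : forall i j : chart_index M,
    open (chart_map i @` (chart_dom i `&` chart_dom j));
  transition_smooth : forall i j : chart_index M,
    smooth_on (chart_map i @` (chart_dom i `&` chart_dom j)) (transition i j);
  manifold_hausdorff : hausdorff_space M;
  manifold_second_countable : @second_countable M }.

Definition smooth_function M (f : M -> R) : Prop :=
  forall i : chart_index M,
    smooth_on (chart_map i @` chart_dom i) (f \o chart_inv i).

(* A tangent vector assigns to each chart around its base point a coordinate
   vector, these being related by the Jacobians of the transition maps. The
   value 0 at the other charts makes Leibniz equality the intended one. *)
Record tangent_vector M := TangentVector {
  base : M;
  coord : chart_index M -> 'rV[R]_(mdim M);
  coord_out : forall i, ~ chart_dom i base -> coord i = 0;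
  coord_change : forall i j, chart_dom i base -> chart_dom j base ->
    coord j = 'D_(coord i) (transition i j) (chart_map i base) }.

Lemma zero_vector_change M (p : M) (i j : chart_index M) :
  chart_dom i p -> chart_dom j p ->
  (0 : 'rV[R]_(mdim M)) = 'D_0 (transition i j) (chart_map i p).
Proof.
by move=> _ _; have [_ ->] := is_derive0 (transition i j) (chart_map i p).
Qed.

Definition zero_vector M (p : M) : tangent_vector M :=
  @TangentVector M p (fun=> 0) (fun _ _ => erefl) (@zero_vector_change M p).

Definition tangent_bundle M : atlas R := {|
  carrier := tangent_vector M;
  origin := zero_vector (origin M);
  mdim := (mdim M + mdim M)%N;
  chart_index := chart_index M;
  chart_dom := fun i => [set v | chart_dom i (base v)];
  chart_map := fun i v => row_mx (chart_map i (base v)) (coord v i);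
  chart_at := fun v => chart_at (base v) |}.

(* df(v); the choice of a chart is immaterial *)
Definition differential M (f : M -> R) (v : tangent_vector M) : R :=
  let i := chart_at (base v) in
  'D_(coord v i) (f \o chart_inv i) (chart_map i (base v)).

Record vector_field M := VectorField {
  vf_val :> M -> tangent_vector M;
  vf_base : forall p, base (vf_val p) = p;
  vf_smooth : forall i : chart_index M,
    smooth_on (chart_map i @` chart_dom i)
      (fun x => coord (vf_val (chart_inv i x)) i) }.

HB.instance Definition _ M := gen_eqMixin (vector_field M).
HB.instance Definition _ M := gen_choiceMixin (vector_field M).

Lemma zero_field_smooth M (i : chart_index M) :
  smooth_on (chart_map i @` chart_dom i)
    (fun x => coord (zero_vector (chart_inv i x)) i).
Proof.
move=> k; rewrite /=; elim: k => [x _|k IHk]; first exact: cst_continuous.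
split=> [x _|v]; first exact: differentiable_cst.
suff -> : 'D_v (fun=> 0 : 'rV[R]_(mdim M)) =
    (fun=> 0) :> ('rV[R]_(mdim M) -> 'rV[R]_(mdim M)) by [].
by apply/funext => x; exact: derive_cst.
Qed.

Definition zero_field M : vector_field M :=
  @VectorField M (@zero_vector M) (fun=> erefl) (@zero_field_smooth M).

Definition vf_apply M (X : vector_field M) (f : M -> R) (p : M) : R :=
  differential f (X p).

Definition function_lift M (f : M -> R) : tangent_bundle M -> R :=
  @differential M f.

Definition is_complete_lift M (X : vector_field M)
    (Y : vector_field (tangent_bundle M)) : Prop :=
  forall f : M -> R, smooth_function f ->
    vf_apply Y (function_lift f) = function_lift (vf_apply X f).

(* "the unique vector field such that ..."; zero_field is a dummy value *)
Definition complete_lift M (X : vector_field M) :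
    vector_field (tangent_bundle M) :=
  xget (zero_field (tangent_bundle M)) (is_complete_lift X).

Definition absolutely_continuous (W : normedModType R) (a b : R)
    (g : R -> W) : Prop :=
  forall eps : R, 0 < eps -> exists2 delta : R, 0 < delta &
    forall (k : nat) (x y : 'I_k -> R),
      (forall i, [/\ a <= x i, x i <= y i & y i <= b]) ->
      trivIset setT (fun i => [set` `]x i, y i[]) ->
      \sum_(i < k) (y i - x i) < delta ->
      \sum_(i < k) `|g (y i) - g (x i)| < eps.

(* c restricted to [0, T] is a solution of c' = X0(c) + \sum_i u_i X_i(c);
   the values of c outside [0, T] are irrelevant. *)
Record is_solution N (m : nat) (X0 : vector_field N)
    (X : 'I_m -> vector_field N) (u : R -> 'rV[R]_m) (T : R) (c : R -> N) :
    Prop := IsSolution {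
  solution_continuous : {within `[0, T], continuous c};
  solution_ac : forall (i : chart_index N) (a b : R), 0 <= a -> b <= T ->
    (forall t, a <= t <= b -> chart_dom i (c t)) ->
    absolutely_continuous a b (chart_map i \o c);
  solution_ode : {ae @lebesgue_measure R, forall t : R, 0 < t < T ->
    forall i : chart_index N, chart_dom i (c t) ->
      is_derive t 1 (chart_map i \o c)
        (coord (X0 (c t)) i
         + \sum_(k < m) u t 0 k *: coord (X k (c t)) i)} }.

Definition controllable N (m : nat) (adm : set (R -> 'rV[R]_m))
    (X0 : vector_field N) (X : 'I_m -> vector_field N) : Prop :=
  forall p q : N, exists (T : R) (u : R -> 'rV[R]_m) (c : R -> N),
    [/\ 0 < T, adm u, is_solution X0 X u T c, c 0 = p & c T = q].

(* inverse images of Borel sets belong to the completed sigma-algebra *)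
Definition lebesgue_measurable (g : R -> R) : Prop :=
  forall B : set R, measurable B ->
    measurable_realfun.completed_algebra_gen (@lebesgue_measure R) (g @^-1` B).

Definition control_class (m : nat) (U : set 'rV[R]_m)
    (adm : set (R -> 'rV[R]_m)) : Prop :=
  forall u, adm u ->
    [/\ forall t, U (u t),
        forall k : 'I_m, lebesgue_measurable (fun t => u t 0 k)
      & forall a b : R, exists K : R, forall t, a <= t <= b -> `|u t| <= K].

End Manifolds.

(* Main.v *)
Require Import Defs.
From mathcomp Require Import all_boot all_order all_algebra.
From mathcomp Require Import all_classical all_reals all_analysis.
From mathcomp Require Import measurable_realfun ring lra.
Set Implicit Arguments.
Unset Strict Implicit.
Unset Printing Implicit Defensive.
Import Order.TTheory GRing.Theory Num.Theory.
Import numFieldNormedType.Exports.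
Local Open Scope classical_set_scope.
Local Open Scope ring_scope.

(** The complete lift of a vector field is tangent to the zero section of TM.
    Indeed, at the zero vector over p, (X f)^c vanishes, while X^c (f^c) is
    df_p applied to the vertical part of X^c; hence this vertical part is
    annihilated by the differentials of all functions, and bump functions show
    that it is zero. Therefore, in a chart, the vertical component v of a
    solution satisfies |v'| <= K |v| almost everywhere near a zero of v, so a
    solution which starts in the zero section stays in it, and no nonzero
    tangent vector is reachable from a zero vector. This only uses the defining
    property of the lift: if no lift existed, the dummy value, a zero field,
    would be tangent to the zero section as well. *)

(** * Mean value inequalities *)

(** Controls are only measurable and locally bounded, so a solution is differentiable only almost
    everywhere, and what ties its increments to that derivative is absolute continuity. The estimate
    [|v'| <= K |v|] therefore becomes an increment bound through a covering argument rather than an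
    integral: intervals around good times are bounded by the derivative, the others lie in an open
    set of small measure. The second obstacle is that v exists only chart by chart. Being a zero
    vector does not depend on the chart, and induction along the time interval asks for a claim near
    one time at a time, hence within a single chart. For TM three facts are established: injective
    charts, open images of overlaps, continuous transition maps. They provide the expected
    neighbourhoods in TM. Derivatives on TM at the zero section are computed directly as limits of
    difference quotients. *)

(** Apply the local step at the supremum of the times satisfying [P]: it leads from such a time just
    below to one strictly above, unless [b] caps it. Steps straddle [t], so [P t] itself need not be
    known first. *)
Lemma interval_induction (R : realType) (P : R -> Prop) (a b : R) :
  a <= b -> P a ->
  (forall t, a <= t <= b -> exists2 r, 0 < r & forall s1 s2,
     a <= s1 -> s2 <= b -> s1 <= t <= s2 -> t - r < s1 -> s2 < t + r ->
     P s1 -> P s2) ->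
  P b.
Proof.
move=> ab Pa loc; pose S := [set t | a <= t <= b /\ P t].
have Sa : S a by split=> //; rewrite lexx.
have ubS : ubound S b by move=> t [/andP[]].
have hS : has_sup S by split; [exists a | exists b].
have sb : sup S <= b by apply: ge_sup => //; exists a.
have sa : a <= sup S by apply: sup_upper_bound.
have [|r r0 step] := loc (sup S); first by rewrite sa.
have [s1 [/andP[as1 s1b] Ps1] lts1] := sup_adherent r0 hS.
have s1s : s1 <= sup S by apply: sup_upper_bound => //; split=> //; rewrite as1.
pose s2 := Num.min b (sup S + r / 2).
have s2b : s2 <= b by rewrite ge_min lexx.
have ss2 : sup S <= s2 by rewrite le_min sb /=; lra.
have s2r : s2 < sup S + r by rewrite gt_min; apply/orP; right; lra.
have Ps2 : P s2 by apply: (step s1) => //; rewrite s1s.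
have : s2 <= sup S by apply: sup_upper_bound => //; split=> //; rewrite s2b andbT; lra.
have [<- //|b_s2] := eqVneq s2 b.
by move: b_s2; rewrite /s2 minElt; case: ifP => [|_ _]; [rewrite eqxx | lra].
Qed.

Section MeanValue.
Variables (R : realType) (W : normedModType R).
Local Notation mu := (@lebesgue_measure R).

(** Lets an open set of small measure trigger absolute continuity on any disjoint intervals inside
    it. *)
Lemma sum_itv_le_measure (O : set R) (k : nat) (x y : 'I_k -> R) :
  open O -> (forall i, x i <= y i) ->
  (forall i, [set` `]x i, y i[] `<=` O) ->
  trivIset setT (fun i => [set` `]x i, y i[]) ->
  ((\sum_(i < k) (y i - x i))%:E <= mu O)%E.
Proof.
move=> oO xy sO tI.
have -> : (\sum_(i < k) (y i - x i))%:E = (\sum_(i < k) mu [set` `]x i, y i[])%E.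
  rewrite -sumEFin; apply: eq_bigr => i _; rewrite lebesgue_measure_itv /= lte_fin.
  by have := xy i; rewrite le_eqVlt => /predU1P[->|->//]; rewrite ltxx subrr.
rewrite -measure_semi_additive_ord //; last first.
  exact: bigsetU_measurable.
apply: le_measure; rewrite ?inE; first exact: bigsetU_measurable.
  exact: open_measurable.
by elim/big_ind: _ => // A B AO BO t [/AO|/BO].
Qed.

Lemma negligible_open_cover (E : set R) (d : R) :
  mu.-negligible E -> 0 < d ->
  exists O : set R, [/\ open O, E `<=` O & (mu O < d%:E)%E].
Proof.
move=> [A [mA muA EA]] d0.
have muAy : (mu A < +oo)%E by rewrite muA.
have [U [oU AU muU]] := @lebesgue_regularity_outer R A d mA muAy d0.
exists U; split=> //; first exact: subset_trans EA AU.
apply: le_lt_trans muU; rewrite -[in leLHS](setDKU AU).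
have mU := open_measurable oU.
apply: le_trans (measureU2 _ _ _) _ => //; first exact: measurableD.
by rewrite (_ : _ A = 0%E) ?adde0.
Qed.

(** Go through [t]: since [t] lies between [s1] and [s2], the two distances add up to exactly
    [s2 - s1]. This is what fits straddling steps of the induction. *)
Lemma local_increment (g : R -> W) (a b L r t s1 s2 : R) :
  (forall s, a <= s <= b -> `|s - t| < r -> `|g s - g t| <= L * `|s - t|) ->
  a <= s1 -> s2 <= b -> s1 <= t <= s2 -> t - r < s1 -> s2 < t + r ->
  `|g s2 - g s1| <= L * (s2 - s1).
Proof.
move=> lip as1 s2b /andP[s1t ts2] rs1 rs2.
have h1 : `|g s2 - g t| <= L * (s2 - t).
  rewrite -[s2 - t]ger0_norm ?subr_ge0 //.
  by apply: lip; [lra | rewrite ger0_norm ?subr_ge0 //; lra].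
have h2 : `|g s1 - g t| <= L * (t - s1).
  rewrite -[t - s1]ger0_norm ?subr_ge0 // distrC [`|t - s1|]distrC distrC.
  by apply: lip; [lra | rewrite distrC ger0_norm ?subr_ge0 //; lra].
rewrite -(subrKA (g t)) -(opprB (g s1) (g t)).
by apply: le_trans (ler_normB _ _) _; apply: le_trans (lerD h1 h2) _; lra.
Qed.

Lemma mean_value_inequality (g : R -> W) (a b C : R) :
  a <= b ->
  (forall t, a <= t <= b -> forall e : R, 0 < e ->
     exists2 r : R, 0 < r & forall s, a <= s <= b -> `|s - t| < r ->
       `|g s - g t| <= (C + e) * `|s - t|) ->
  `|g b - g a| <= C * (b - a).
Proof.
move=> ab lip.
suff H (e : R) : 0 < e -> `|g b - g a| <= (C + e) * (b - a).
  (* The summand 1 keeps the denominator positive when [a = b]. *)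
  apply/ler_addgt0Pr => e e0; pose e' := e / (1 + (b - a)).
  have k0 : 0 < 1 + (b - a) by rewrite ltr_pwDl // subr_ge0.
  have e'0 : 0 < e' by rewrite divr_gt0.
  have ee' : e' * (1 + (b - a)) = e by rewrite divfK // gt_eqF.
  by apply: le_trans (H e' e'0) _; lra.
move=> e0; pose P t := `|g t - g a| <= (C + e) * (t - a).
apply: (@interval_induction _ P a b ab) => [|t tab].
  by rewrite /P !subrr normr0 mulr0.
have [r r0 rlip] := lip t tab _ e0.
exists r => // s1 s2 as1 s2b s1ts2 rs1 rs2; rewrite /P => Ps1.
rewrite -(subrKA (g s1)); apply: le_trans (ler_normD _ _) _.
apply: le_trans (lerD (local_increment rlip as1 s2b s1ts2 rs1 rs2) Ps1) _.
lra.
Qed.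

(* Cousin's argument for the gauge that shrinks into an open set of small measure
   at the exceptional points: there absolute continuity bounds the increments,
   elsewhere the local Lipschitz bound does. *)
Lemma ae_mean_value_inequality (g : R -> W) (a b C : R) (E : set R) :
  a <= b -> 0 <= C -> absolutely_continuous a b g -> mu.-negligible E ->
  (forall t, a <= t <= b -> ~ E t -> forall e : R, 0 < e ->
     exists2 r : R, 0 < r & forall s, a <= s <= b -> `|s - t| < r ->
       `|g s - g t| <= (C + e) * `|s - t|) ->
  `|g b - g a| <= C * (b - a).
Proof.
move=> ab C0 acg nE lip.
suff H (e : R) : 0 < e -> `|g b - g a| <= (C + e) * (b - a) + e.
  apply/ler_addgt0Pr => e e0; pose e' := e / (1 + (b - a)).
  have k0 : 0 < 1 + (b - a) by rewrite ltr_pwDl // subr_ge0.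
  have e'0 : 0 < e' by rewrite divr_gt0.
  have ee' : e' * (1 + (b - a)) = e by rewrite divfK // gt_eqF.
  by apply: le_trans (H e' e'0) _; lra.
move=> e0; have [d d0 acd] := acg _ e0.
have [U [oU EU muU]] := negligible_open_cover nE d0.
have Ce : 0 <= C + e by apply: addr_ge0 => //; apply: ltW.
(* Absolute continuity bounds a total over a whole family, not each increment separately. The
   intervals around exceptional points are therefore collected along the induction, in increasing
   order so that they are disjoint, and estimated once at the end. *)
pose P t := exists (k : nat) (x y : nat -> R), [/\
  forall i, (i < k)%N -> [/\ a <= x i, x i <= y i, y i <= t
                          & [set` `]x i, y i[] `<=` U],
  forall i j, (i < j)%N -> (j < k)%N -> y i <= x j
  & `|g t - g a| <= (C + e) * (t - a) + \sum_(i < k) `|g (y i) - g (x i)|].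
have Pb : P b.
  apply: (@interval_induction _ P a b) => //.
    exists 0%N, (fun=> 0), (fun=> 0); split=> //.
    by rewrite big_ord0 !subrr normr0 mulr0 addr0.
  move=> t tab; have [Et|nEt] := pselect (E t).
    (* At an exceptional point nothing bounds the increment yet: the interval from [s1] to [s2] lies
       in [U] and is appended to the family. *)
    have /nbhs_ballP[r /= r0 rU] : nbhs t U by apply: open_nbhs_nbhs; split=> //; apply: EU.
    exists r => // s1 s2 as1 s2b /andP[s1t ts2] rs1 rs2 [k [x [y [xy yx Pst]]]].
    exists k.+1, (fun i => if (i < k)%N then x i else s1),
      (fun i => if (i < k)%N then y i else s2); split.
    - move=> i ik; case: ltnP => [/xy[? ? yis1 ?]|_].
        by split=> //; lra.
      split=> //; first lra.
      move=> z /=; rewrite in_itv /= => /andP[s1z zs2]; apply: rU.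
      by rewrite /ball /= ltr_norml; apply/andP; split; lra.
    - move=> i j ij; rewrite ltnS => jk; rewrite (leq_trans ij jk).
      case: ltnP => jk'; first exact: yx.
      by have [] := xy i (leq_trans ij jk).
    - rewrite big_ord_recr /= ltnn.
      under eq_bigr => i _ do rewrite ltn_ord.
      have -> : g s2 - g a = (g s1 - g a) + (g s2 - g s1).
        by rewrite [RHS]addrC subrKA.
      apply: le_trans (ler_normD _ _) _; rewrite addrA lerD2r.
      apply: le_trans Pst _; rewrite lerD2r ler_wpM2l //; lra.
  have [r r0 rlip] := lip t tab nEt _ e0.
  exists r => // s1 s2 as1 s2b s1ts2 rs1 rs2 [k [x [y [xy yx Pst]]]].
  exists k, x, y; split=> //.
    by case/andP: s1ts2 => s1t ts2 i /xy[? ? ? ?]; split=> //; lra.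
  rewrite -(subrKA (g s1)); apply: le_trans (ler_normD _ _) _.
  apply: le_trans (lerD (local_increment rlip as1 s2b s1ts2 rs1 rs2) Pst) _.
  lra.
have [k [x [y [xy yx]]]] := Pb.
move=> /le_trans; apply; rewrite lerD2l; apply: ltW.
have tI : trivIset [set: 'I_k] (fun i : 'I_k => [set` `](x i), (y i)[]).
  move=> i j _ _ [z [/=]]; rewrite !in_itv /= => /andP[xi yi] /andP[xj yj].
  apply/val_inj; case: (ltngtP i j) => // ij; exfalso.
    by have := yx _ _ ij (ltn_ord j); lra.
  by have := yx _ _ ij (ltn_ord i); lra.
apply: (acd k (fun i => x i) (fun i => y i)) => //.
  by move=> i; have [] := xy i (ltn_ord i).
rewrite -lte_fin; apply: le_lt_trans muU.
by apply: sum_itv_le_measure => // i; have [] := xy i (ltn_ord i).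
Qed.

End MeanValue.

(** * Calculus of C^k functions *)

Section ChainRule.
Variable R : realType.

Lemma derive_comp (U V W : normedModType R) (f : U -> V) (g : V -> W) (x v : U) :
  differentiable f x -> differentiable g (f x) ->
  'D_v (g \o f) x = 'D_('D_v f x) g (f x).
Proof.
move=> df dg; have dgf := differentiable_comp df dg.
by rewrite !deriveE // diff_comp.
Qed.

Lemma deriveZdir (V W : normedModType R) (f : V -> W) (x v : V) (c : R) :
  differentiable f x -> 'D_(c *: v) f x = c *: 'D_v f x.
Proof. by move=> df; rewrite !deriveE // linearZ. Qed.

Lemma derive_realdir (h : R -> R) (s c : R) :
  differentiable h s -> 'D_c h s = c * 'D_1 h s.
Proof. by move=> dh; rewrite -[in LHS](mulr1 c); exact: deriveZdir. Qed.

End ChainRule.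

Section CkCalculus.
Variables (R : realType) (V : normedModType R).
Implicit Types (A B : set V) (k : nat).

Lemma Ck_on_subset (W : normedModType R) k A B (f : V -> W) :
  A `<=` B -> Ck_on k B f -> Ck_on k A f.
Proof.
move=> AB; elim: k f => [|k IHk] f /=; first by move=> cf x /AB; apply: cf.
by move=> [df Df]; split=> [x /AB|v]; [apply: df | apply: IHk].
Qed.

Lemma Ck_on_setU (W : normedModType R) k A B (f : V -> W) :
  Ck_on k A f -> Ck_on k B f -> Ck_on k (A `|` B) f.
Proof.
elim: k f => [|k IHk] f /=; first by move=> fA fB x [/fA|/fB].
by move=> [dA DA] [dB DB]; split=> [x [/dA|/dB]|v] //; apply: IHk.
Qed.

Lemma Ck_onW (W : normedModType R) k A (f : V -> W) :
  Ck_on k.+1 A f -> Ck_on k A f.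
Proof.
elim: k f => [|k IHk] f [df Df]; last first.
  by split=> // v; apply: IHk; apply: Df.
by move=> x Ax; apply/differentiable_continuous/df.
Qed.

Lemma differentiable_near_eq (W : normedModType R) (f g : V -> W) (x : V) :
  (\near x, f x = g x) -> differentiable f x -> differentiable g x.
Proof.
move=> fg df; have [cdf dfE] := (diff_locallyP _ _).1 df.
have dgE : g \o shift x = cst (g x) + 'd f x +o_ 0 id.
  apply/eqaddoP => e e0; have := (eqaddoP _ _ _ _).1 dfE _ e0.
  have fgx : f x = g x := nbhs_singleton fg.
  have fg0 : \forall y \near 0, f (y + x) = g (y + x).
    have : y + x @[y --> 0] --> 0 + x by apply: cvgD; [exact: cvg_id | exact: cvg_cst].
    by rewrite add0r => /(_ _ fg).
  move=> fe; near=> y.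
  have -> : (g \o shift x - (cst (g x) + 'd f x)) y =
            (f \o shift x - (cst (f x) + 'd f x)) y.
    have fgy : f (y + x) = g (y + x) by near: y.
    by rewrite !fctE /= fgy fgx.
  by near: y.
have dgf := diff_unique cdf dgE.
by apply/diff_locallyP; rewrite dgf.
Unshelve. all: by end_near. Qed.


(** Continuity and derivatives at a point see a neighbourhood of it, which openness of [A] supplies.
    This permits computing with formulas that hold only inside a chart image, where [chart_inv] is
    meaningful. *)
Lemma Ck_on_eq (W : normedModType R) k A (f g : V -> W) :
  open A -> (forall x, A x -> f x = g x) -> Ck_on k A f -> Ck_on k A g.
Proof.
move=> oA; elim: k f g => [|k IHk] f g fg /=.
  move=> cf x Ax; have nA : \near x, f x = g x.
    by near=> y; apply: fg; near: y; apply: open_nbhs_nbhs.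
  have cfx : f y @[y --> x] --> g x by rewrite -(fg _ Ax); exact: cf.
  apply: cvg_trans cfx; exact: near_eq_cvg.
move=> [df Df]; split=> [x Ax|v].
  apply: differentiable_near_eq (df x Ax).
  by near=> y; apply: fg; near: y; apply: open_nbhs_nbhs.
apply: IHk (Df v) => x Ax; apply: near_eq_derive.
by near=> y; apply: fg; near: y; apply: open_nbhs_nbhs.
Unshelve. all: by end_near. Qed.

Lemma Ck_on_cst (W : normedModType R) k A (w : W) : Ck_on k A (fun=> w).
Proof.
elim: k w => [|k IHk] w /=; first by move=> x _; apply: cst_continuous.
split=> [x _|v]; first exact: differentiable_cst.
rewrite (_ : 'D_v _ = fun=> 0); first exact: IHk.
by apply/funext => x; apply: derive_cst.
Qed.

Lemma Ck_onD (W : normedModType R) k A (f g : V -> W) : open A ->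
  Ck_on k A f -> Ck_on k A g -> Ck_on k A (fun x => f x + g x).
Proof.
move=> oA; elim: k f g => [|k IHk] f g /=.
  by move=> cf cg x Ax; apply: continuousD; [apply: cf | apply: cg].
move=> [df Df] [dg Dg]; split=> [x Ax|v].
  by apply: differentiableD; [apply: df | apply: dg].
apply: Ck_on_eq oA _ (IHk _ _ (Df v) (Dg v)) => x Ax.
by rewrite -deriveD //; apply: diff_derivable; [apply: df | apply: dg].
Qed.

Lemma Ck_onM k A (f g : V -> R) : open A ->
  Ck_on k A f -> Ck_on k A g -> Ck_on k A (fun x => f x * g x).
Proof.
move=> oA; elim: k f g => [|k IHk] f g.
  by move=> cf cg x Ax; apply: continuousM; [apply: cf | apply: cg].
move=> /[dup] /Ck_onW cf [df Df] /[dup] /Ck_onW cg [dg Dg]; split=> [x Ax|v].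
  by apply: differentiableM; [apply: df | apply: dg].
apply: Ck_on_eq oA _ (Ck_onD oA (IHk _ _ cf (Dg v)) (IHk _ _ cg (Df v))) => x Ax.
by rewrite [RHS]deriveM //; apply: diff_derivable; [apply: df | apply: dg].
Qed.

Lemma Ck_on_sum k A n (f : 'I_n -> V -> R) : open A ->
  (forall i, Ck_on k A (f i)) -> Ck_on k A (fun x => \sum_i f i x).
Proof.
move=> oA; elim: n f => [|n IHn] f cf.
  by apply: Ck_on_eq oA _ (Ck_on_cst k A (0 : R)) => x _; rewrite big_ord0.
apply: Ck_on_eq oA _ (Ck_onD oA (IHn (fun i => f (widen_ord (leqnSn n) i)) _)
  (cf ord_max)) => [x _|i]; first by rewrite big_ord_recr.
exact: cf.
Qed.

Lemma Ck_on_coord m n k A (f : V -> 'M[R]_(m, n)) i j : open A ->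
  Ck_on k A f -> Ck_on k A (fun x => f x i j).
Proof.
move=> oA; elim: k f => [|k IHk] f /=.
  move=> cf x Ax; apply: (@continuous_comp _ _ _ f (fun M : 'M[R]_(m, n) => M i j)).
    exact: cf.
  exact: coord_continuous.
move=> [df Df]; split=> [x Ax|v].
  apply: (@differentiable_comp _ _ _ _ f (fun M : 'M[R]_(m, n) => M i j)).
    exact: df.
  exact: differentiable_coord.
apply: Ck_on_eq oA _ (IHk _ (Df v)) => x Ax.
by rewrite derive_mx ?mxE //; apply: diff_derivable; apply: df.
Qed.

Lemma Ck_on_id k A : open A -> Ck_on k A (fun x : V => x).
Proof.
move=> oA; case: k => [|k]; first by move=> x _; exact: cvg_id.
split=> [x _|v]; first exact: (@ex_diff _ _ _ _ _ _ _ (is_diff_id x)).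
by rewrite (_ : 'D_v _ = fun=> v); [exact: Ck_on_cst | apply/funext => x; exact: derive_id].
Qed.

End CkCalculus.

(** * Smoothness of exp(-1/s) extended by zero *)

Section FlatFunction.
Variable R : realType.

(** [flat 0] is the classical exp(-1/s). The factors s^(-n) are what differentiation produces, so
    the family indexed by [n] has its derivatives in its own span. *)
Definition flat (n : nat) (s : R) : R :=
  if 0 < s then s^-1 ^+ n * expR (- s^-1) else 0.

Lemma flat_le0 n s : s <= 0 -> flat n s = 0.
Proof. by rewrite /flat leNgt => /negbTE ->. Qed.

Lemma flat_gt0 n s : 0 < s -> 0 < flat n s.
Proof.
by move=> s0; rewrite /flat s0 mulr_gt0 ?expR_gt0 // exprn_gt0 // invr_gt0.
Qed.

(** With x = 1/s, the exponential series gives e^x >= x^(n+2) / (n+2)!. Order two in s makes the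
    difference quotient at 0 tend to 0. *)
Lemma flat_quadratic n s : `|flat n s| <= (n.+2)`!%:R * s ^+ 2.
Proof.
rewrite /flat; case: ifPn => [s0|_]; last first.
  by rewrite normr0 mulr_ge0 // sqr_ge0.
have x0 : 0 < s^-1 by rewrite invr_gt0.
rewrite ger0_norm; last by rewrite mulr_ge0 ?expR_ge0 // exprn_ge0 // ltW.
have -> : s ^+ 2 = (s^-1 ^+ 2)^-1 by rewrite exprVn invrK.
rewrite expRN ler_pdivrMr ?expR_gt0 //.
rewrite mulrAC ler_pdivlMr ?exprn_gt0 // -exprD addn2.
have := expR_ge1Dxn n.+1 (ltW x0).
have f0 : 0 < (n.+2)`!%:R :> R by rewrite ltr0n fact_gt0.
move=> h; rewrite -ler_pdivrMl // mulrC; apply: le_trans h.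
by rewrite lerDr.
Qed.

Lemma is_derive_flat n (s : R) :
  is_derive s 1 (flat n) (flat n.+2 s - n%:R * flat n.+1 s).
Proof.
have [s0|s0|->] := ltgtP s 0.
- rewrite !flat_le0 ?(ltW s0) // mulr0 subr0.
  apply: near_eq_is_derive (is_derive_cst (0 : R) s 1).
  by near=> t; rewrite flat_le0 //; apply/ltW; near: t; exact: lt_nbhsl.
- apply: (@near_eq_is_derive R R R (fun t : R => t^-1 ^+ n * expR (- t^-1))).
    near=> t; have t0 : 0 < t by near: t; exact: lt_nbhsr.
    by rewrite /flat t0.
  have s_neq0 : s != 0 by rewrite gt_eqF.
  have dinv : is_derive s 1 (fun t : R => t^-1) (- s ^- 2).
    by apply: is_derive_eq (is_deriveV s_neq0 (is_derive_id s 1)) _; rewrite [_ *: _]mulr1.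
  rewrite /flat s0; elim: n => [|n IHn].
    rewrite mul0r subr0 (_ : (fun t => _) = expR \o (fun t => - t^-1)); last first.
      by apply/funext => t /=; rewrite expr0 mul1r.
    apply: is_derive_eq (is_derive1_comp (is_derive_expR _) (is_deriveN dinv)) _.
    by rewrite opprK mulrC exprVn.
  rewrite (_ : (fun t => _) = (fun t => t^-1) * (fun t => t^-1 ^+ n * expR (- t^-1))).
    apply: is_derive_eq (is_deriveM dinv IHn) _.
    by rewrite /GRing.scale /= -exprVn !exprS -natr1; ring.
  by apply/funext => t; rewrite fctE exprS mulrA.
- rewrite !flat_le0 // mulr0 subr0.
  suff c : h^-1 *: ((flat n \o shift 0) (h *: 1) - flat n 0) @[h --> 0^'] --> (0 : R).
    by apply: DeriveDef; [apply/cvg_ex; exists 0 | apply/cvg_lim].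
  apply/cvgrPdist_le => e e0; near=> h.
  have h0 : h != 0 by near: h; exact: nbhs_dnbhs_neq.
  rewrite /= addr0 [_ *: 1]mulr1 (flat_le0 n (lexx 0)) subr0 sub0r normrN normrM normfV.
  rewrite ler_pdivrMl ?normr_gt0 //; apply: le_trans (flat_quadratic n h) _.
  have -> : h ^+ 2 = `|h| * `|h| by rewrite -expr2 real_normK ?num_real.
  rewrite mulrCA; apply: ler_wpM2l => //.
  rewrite -ler_pdivlMl ?ltr0n ?fact_gt0 // mulrC; near: h.
  by apply: dnbhs0_le; rewrite divr_gt0 // ltr0n fact_gt0.
Unshelve. all: by end_near. Qed.

(** The induction on [k] runs over all [n] at once, since the derivative of [flat n] involves
    [flat n.+1] and [flat n.+2]. *)
Lemma Ck_on_flat (V : normedModType R) k (A : set V) n (g : V -> R) : open A ->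
  Ck_on k A g -> Ck_on k A (flat n \o g).
Proof.
move=> oA; have dflat m s : differentiable (flat m) s.
  by apply/derivable1_diffP; have [] := is_derive_flat m s.
elim: k n => [|k IHk] n.
  move=> cg x Ax; apply: continuous_comp; first exact: cg.
  exact/differentiable_continuous/dflat.
move=> /[dup] /Ck_onW cg [dg Dg]; split=> [x Ax|v].
  by apply: differentiable_comp => //; exact: dg.
have c1 := Ck_onM oA (Ck_on_cst k A (- n%:R : R)) (IHk n.+1 cg).
apply: Ck_on_eq oA _ (Ck_onM oA (Dg v) (Ck_onD oA (IHk n.+2 cg) c1)) => x Ax.
rewrite [RHS]derive_comp //; last exact: dg.
rewrite (derive_realdir _ (dflat n (g x))).
by have [_ ->] := is_derive_flat n (g x); rewrite /= mulNr.
Qed.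

End FlatFunction.

(** * Norms of matrices and local Lipschitz bounds *)

Section MatrixNorm.
Variable R : realType.

Lemma mx_norm_leP m n (A : 'M[R]_(m, n)) (e : R) : 0 <= e ->
  `|A| <= e <-> forall i j, `|A i j| <= e.
Proof.
move=> e0; rewrite [`|A|]mx_normrE; split=> [Ae i j|Ae].
  apply: le_trans Ae; exact: (le_bigmax _ (fun ij => `|A ij.1 ij.2|) (i, j)).
by apply: bigmax_le => // ij _; apply: Ae.
Qed.

Lemma row_mx_norm_le m n1 n2 (A : 'M[R]_(m, n1)) (B : 'M[R]_(m, n2)) (e : R) :
  `|A| <= e -> `|B| <= e -> `|row_mx A B| <= e.
Proof.
move=> Ae Be; have e0 : 0 <= e := le_trans (normr_ge0 _) Ae.
apply/mx_norm_leP => // i j; rewrite mxE; case: splitP => k _.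
  by apply: (mx_norm_leP A e0).1.
by apply: (mx_norm_leP B e0).1.
Qed.

Lemma lsubmx_norm_le m n1 n2 (A : 'M[R]_(m, n1 + n2)) : `|lsubmx A| <= `|A|.
Proof. by apply/mx_norm_leP => // i j; rewrite mxE; apply: (mx_norm_leP A _).1. Qed.

Lemma rsubmx_norm_le m n1 n2 (A : 'M[R]_(m, n1 + n2)) : `|rsubmx A| <= `|A|.
Proof. by apply/mx_norm_leP => // i j; rewrite mxE; apply: (mx_norm_leP A _).1. Qed.

Lemma cvg_row_mx (T : Type) (F : set_system T) {FF : Filter F} m n1 n2
    (f : T -> 'M[R]_(m, n1)) (g : T -> 'M[R]_(m, n2)) (a : 'M[R]_(m, n1))
    (b : 'M[R]_(m, n2)) :
  f @ F --> a -> g @ F --> b -> (fun x => row_mx (f x) (g x)) @ F --> row_mx a b.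
Proof.
move=> /cvgrPdist_le fa /cvgrPdist_le gb; apply/cvgrPdist_le => e e0; near=> x.
rewrite opp_row_mx add_row_mx.
by apply: row_mx_norm_le; near: x; [apply: fa | apply: gb].
Unshelve. all: by end_near. Qed.

End MatrixNorm.

Section LocalLipschitz.
Variables (R : realType) (W : normedModType R).

Lemma continuous_sum (T : topologicalType) (I : Type) (r : seq I) (f : I -> T -> W) x :
  (forall i, {for x, continuous (f i)}) ->
  {for x, continuous (fun y => \sum_(i <- r) f i y)}.
Proof.
move=> cf; elim: r => [|i r IHr].
  rewrite (_ : (fun _ => _) = fun=> 0); first exact: cst_continuous.
  by apply/funext => y; rewrite big_nil.
rewrite (_ : (fun _ => _) = fun y => f i y + \sum_(j <- r) f j y).
  exact: continuousD.
by apply/funext => y; rewrite big_cons.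
Qed.

Lemma derive_basis n (f : 'rV[R]_n -> W) x w : differentiable f x ->
  'D_w f x = \sum_(a < n) w 0 a *: 'D_('e_a) f x.
Proof.
move=> df; rewrite deriveE // [in LHS](row_sum_delta w) linear_sum.
by apply: eq_bigr => a _; rewrite linearZ deriveE.
Qed.

(** Puts a bound on a derivative into the form, with slack [e], that the mean value inequalities
    take as hypothesis. *)
Lemma is_derive_increment (g : R -> W) (t C : R) (d : W) :
  is_derive t 1 g d -> `|d| <= C -> forall e : R, 0 < e ->
  exists2 r : R, 0 < r & forall s, `|s - t| < r -> `|g s - g t| <= (C + e) * `|s - t|.
Proof.
move=> [/cvg_ex[l /= gl] dE] dC e e0.
have ld : l = d by rewrite -dE; apply/esym/cvg_lim.
move: gl; rewrite {}ld => /cvgrPdist_le /(_ e e0)[r /= r0 rP].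
exists r => // s sr; have [->|st] := eqVneq s t; first by rewrite !subrr !normr0 mulr0.
have st0 : s - t != 0 by rewrite subr_eq0.
have := rP (s - t); rewrite /ball /= sub0r normrN => /(_ sr st0).
rewrite /= [_ *: 1]mulr1 subrK.
set q := _^-1 *: _ => dq.
have -> : g s - g t = (s - t) *: q by rewrite /q scalerA mulfV // scale1r.
rewrite normrZ mulrC ler_wpM2r //.
have -> : q = d - (d - q) by rewrite opprB addrC subrK.
by apply: le_trans (ler_normB _ _) _; rewrite lerD.
Qed.

(** Partial derivatives are bounded near [z0] by continuity, balls are convex, and the mean value
    inequality applies along the segment from [z'] to [z]. *)
Lemma C1_locally_lipschitz n (A : set 'rV[R]_n) (f : 'rV[R]_n -> W) z0 :
  open A -> A z0 -> Ck_on 1 A f ->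
  exists r K : R, [/\ 0 < r, 0 <= K, ball z0 r `<=` A &
    forall z z', ball z0 r z -> ball z0 r z' -> `|f z - f z'| <= K * `|z - z'|].
Proof.
move=> oA Az0 [df Df].
(* By continuity a partial derivative stays within 1 of its value at [z0] on a neighbourhood. *)
pose K (a : 'I_n) := `|'D_('e_a) f z0| + 1.
have nK : \forall z \near z0, forall a, `|'D_('e_a) f z| <= K a.
  have := @filter_forall _ _ (fun a z => `|'D_('e_a) f z| <= K a) (nbhs z0) _.
  apply => a.
  have c := @Df 'e_a _ Az0.
  have /cvgrPdist_le /(_ 1 ltr01) := c.
  apply: filterS => z dz; rewrite /K -[X in `|X|](subrK ('D_('e_a) f z0)) addrC.
  by apply: le_trans (ler_normD _ _) _; rewrite lerD2l distrC.
have /nbhs_ballP[r /= r0 rP] : \forall z \near z0, A z /\ forall a, `|'D_('e_a) f z| <= K a.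
  by apply: filterI nK; apply: open_nbhs_nbhs.
exists r, (\sum_a K a); split=> //; first by apply: sumr_ge0 => a _; rewrite addr_ge0.
  by move=> z /rP[].
move=> z z' zr z'r; pose l (s : R) := z' + s *: (z - z').
have lr (s : R) : 0 <= s <= 1 -> ball z0 r (l s).
  move=> /andP[s0 s1]; rewrite -ball_normE /ball_ /=.
  have -> : z0 - l s = s *: (z0 - z) + (1 - s) *: (z0 - z').
    by apply/matrixP => a b; rewrite !mxE; ring.
  apply: le_lt_trans (ler_normD _ _) _.
  rewrite !normrZ (ger0_norm s0) ger0_norm ?subr_ge0 //.
  move: zr z'r; rewrite -ball_normE /ball_ /= => zr z'r.
  have [s_eq0|s_gt0] := eqVneq s 0; first by rewrite s_eq0 mul0r add0r subr0 mul1r.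
  have : 0 < s * (r - `|z0 - z|) by rewrite mulr_gt0 ?subr_gt0 // lt_neqAle eq_sym s_gt0.
  have : 0 <= (1 - s) * (r - `|z0 - z'|) by rewrite mulr_ge0 ?subr_ge0 // ltW.
  lra.
have dl (s : R) : is_derive s 1 l (z - z').
  have dscale : is_derive s 1 (fun k : R => k *: (z - z')) (z - z').
    have [dk kE] := is_diff_scalel s (z - z').
    by apply: DeriveDef; [exact: diff_derivable | rewrite deriveE // kE scale1r].
  by apply: is_derive_eq (is_deriveD (is_derive_cst z' s 1) dscale) _; rewrite add0r.
have l1 : l 1 = z by rewrite /l scale1r addrC subrK.
have l0 : l 0 = z' by rewrite /l scale0r addr0.
have := @mean_value_inequality _ _ (f \o l) 0 1 ((\sum_a K a) * `|z - z'|) ler01.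
rewrite subr0 mulr1 /= l1 l0; apply=> s s01 e e0.
have [/lr/rP[Als Kls] dls] := (s01, dl s).
have difl : differentiable l s by apply/derivable1_diffP; case: dls.
have dfl : is_derive s 1 (f \o l) ('D_(z - z') f (l s)).
  apply: DeriveDef; first by apply/diff_derivable/differentiable_comp => //; exact: df.
  by rewrite derive_comp //; [case: dls => _ -> | exact: df].
have dfle : `|'D_(z - z') f (l s)| <= (\sum_a K a) * `|z - z'|.
  rewrite derive_basis; last exact: df.
  apply: le_trans (ler_norm_sum _ _ _) _; rewrite mulr_suml; apply: ler_sum => a _.
  rewrite normrZ mulrC ler_pM //.
  by apply: (mx_norm_leP (z - z') _).1.
have [r' r'0 r'P] := is_derive_increment dfl dfle e0.
by exists r' => // t _; apply: r'P.
Qed.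

End LocalLipschitz.

(* [coord] alone now denotes the coordinates in a basis, from vector.v. *)
Local Notation coord := Defs.coord.

(** * Charts of a manifold and of its tangent bundle *)

Section AtlasCharts.
Context {R : realType} (N : atlas R).
Hypothesis injN : forall i : chart_index N, {in chart_dom i &, injective (chart_map i)}.
Implicit Types (i j : chart_index N) (p : N).

Lemma chart_mapK i p : chart_dom i p -> chart_inv i (chart_map i p) = p.
Proof. by move=> ip; rewrite /chart_inv pinvKV ?inE //; exact: injN. Qed.

Lemma transitionE i j p : chart_dom i p -> transition i j (chart_map i p) = chart_map j p.
Proof. by move=> ip; rewrite /transition /= chart_mapK. Qed.

Lemma chart_image_open i (A : set N) :
  open (chart_map i @` chart_dom i) -> open A -> open (chart_map i @` (A `&` chart_dom i)).
Proof.
move=> oi /(_ i)[V oV AV].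
have -> : chart_map i @` (A `&` chart_dom i) = V `&` (chart_map i @` chart_dom i).
  rewrite AV; apply/seteqP; split=> [_ [p [Vp ip] <-]|x [Vx [p ip px]]].
    by split=> //; exists p.
  by exists p => //; split=> //; rewrite /preimage /= px.
exact: openI.
Qed.

(** Openness must be tested in every chart [j], where the set becomes an open part of the overlap
    defined through the transition map. The hypotheses are spelled out so that the lemma applies to
    the tangent bundle. *)
Lemma chart_preimage_open i (V : set 'rV[R]_(mdim N)) :
  (forall j, open (chart_map j @` (chart_dom j `&` chart_dom i))) ->
  (forall j x, (chart_map j @` (chart_dom j `&` chart_dom i)) x ->
     {for x, continuous (transition j i)}) ->
  open V -> open (chart_dom i `&` chart_map i @^-1` V).
Proof.
move=> ooverlap ctrans oV; suff: atlas_open (chart_dom i `&` chart_map i @^-1` V) by [].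
move=> j.
exists ((chart_map j @` (chart_dom j `&` chart_dom i)) `&` (transition j i @^-1` V)).
  rewrite openE => x [Bx Vx]; apply: filterI; first exact: open_nbhs_nbhs.
  by apply: (ctrans j x Bx); apply: open_nbhs_nbhs.
apply/seteqP; split=> [p [[ip Vp] jp]|p [[[q [jq iq] qp] Vq] jp]].
  by split=> //; split; [exists p | rewrite /preimage /= transitionE].
have qpE : q = p by apply: injN qp; rewrite inE.
by move: iq Vq; rewrite /preimage /= qpE => ip; rewrite transitionE.
Qed.

End AtlasCharts.

Section Charts.
Context {R : realType} (M : atlas R) (hM : smooth_manifold M).
Implicit Types (i j k : chart_index M) (p : M).

Local Notation overlap i j := (chart_map i @` (chart_dom i `&` chart_dom j)).

Lemma overlap_refl i : overlap i i = chart_map i @` chart_dom i.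
Proof. by rewrite setIid. Qed.

Lemma chart_codom_open i : open (chart_map i @` chart_dom i).
Proof. by rewrite -overlap_refl; exact: (chart_overlap_open hM). Qed.

Lemma near_overlap i j p : chart_dom i p -> chart_dom j p ->
  \forall x \near chart_map i p, overlap i j x.
Proof.
move=> ip jp; apply: open_nbhs_nbhs; split; first exact: (chart_overlap_open hM).
by exists p.
Qed.

Let injM := chart_map_inj hM.

Lemma transition_differentiable i j p : chart_dom i p -> chart_dom j p ->
  differentiable (transition i j) (chart_map i p).
Proof. by move=> ip jp; apply: (transition_smooth hM i j 1).1; exists p. Qed.

Lemma transition_id i p w : chart_dom i p ->
  'D_w (transition i i) (chart_map i p) = w.
Proof.
move=> ip; rewrite -[RHS](derive_id (chart_map i p) w); apply: near_eq_derive.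
near=> x; have [q [iq _] <-] : overlap i i x by near: x; exact: near_overlap.
exact: transitionE.
Unshelve. all: by end_near. Qed.

(** Chain rule through the transition map. The codomain is arbitrary so that [g] can be a function
    on M or another chart; the latter case is the cocycle rule for Jacobians. *)
Lemma derive_change_chart (W : normedModType R) (g : M -> W) i j p w :
  chart_dom i p -> chart_dom j p ->
  differentiable (g \o chart_inv j) (chart_map j p) ->
  'D_w (g \o chart_inv i) (chart_map i p) =
  'D_('D_w (transition i j) (chart_map i p)) (g \o chart_inv j) (chart_map j p).
Proof.
move=> ip jp dg; rewrite -(transitionE injM j ip) -derive_comp; last first.
- by rewrite transitionE.
- exact: transition_differentiable.
apply: near_eq_derive; near=> x.
have [q [iq jq] <-] : overlap i j x by near: x; exact: near_overlap.
by rewrite /comp transitionE // !chart_mapK.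
Unshelve. all: by end_near. Qed.

Lemma transition_comp i j k p w : chart_dom i p -> chart_dom j p -> chart_dom k p ->
  'D_w (transition i k) (chart_map i p) =
  'D_('D_w (transition i j) (chart_map i p)) (transition j k) (chart_map j p).
Proof.
move=> ip jp kp; apply: derive_change_chart => //.
exact: transition_differentiable.
Qed.

Section TangentAt.
Variables (i : chart_index M) (p : M) (ip : chart_dom i p) (w : 'rV[R]_(mdim M)).

Definition tangent_at_coord j : 'rV[R]_(mdim M) :=
  if `[< chart_dom j p >] then 'D_w (transition i j) (chart_map i p) else 0.

Lemma tangent_at_out j : ~ chart_dom j p -> tangent_at_coord j = 0.
Proof. by move=> jp; rewrite /tangent_at_coord asboolF. Qed.

Lemma tangent_at_change j k : chart_dom j p -> chart_dom k p ->
  tangent_at_coord k = 'D_(tangent_at_coord j) (transition j k) (chart_map j p).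
Proof.
by move=> jp kp; rewrite /tangent_at_coord !asboolT //; exact: transition_comp.
Qed.

(** Realizes any row vector as coordinates at [p]. It makes the chart images of TM full cylinders
    and supplies the unreachable target of the theorem. *)
Definition tangent_at : tangent_vector M :=
  TangentVector tangent_at_out tangent_at_change.

Lemma coord_tangent_at : coord tangent_at i = w.
Proof. by rewrite /= /tangent_at_coord asboolT // transition_id. Qed.

End TangentAt.

(** One chart determines the coordinates in all others: Jacobians give those around the base point,
    and the rest are 0 by [coord_out]. *)
Lemma tangent_vector_eq i (v w : tangent_vector M) : chart_dom i (base v) ->
  base v = base w -> coord v i = coord w i -> v = w.
Proof.
case: v w => [p c c_out c_change] [q d d_out d_change] /= ip pq; subst q => cd.
have cdE : c = d.
  apply/funext => j; have [jp|jp] := pselect (chart_dom j p); last first.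
    by rewrite c_out // d_out.
  by rewrite (c_change i j ip jp) (d_change i j ip jp) cd.
by subst d; congr TangentVector; apply: Prop_irrelevance.
Qed.

Lemma chart_map_inj_tangent (i : chart_index (tangent_bundle M)) :
  {in chart_dom i &, injective (chart_map i)}.
Proof.
move=> v w; rewrite !inE => iv iw /eq_row_mx[bvw cvw].
apply: (@tangent_vector_eq i) => //; apply: injM bvw; by rewrite inE.
Qed.

Let injT := chart_map_inj_tangent.

Lemma tangent_overlapE (i j : chart_index (tangent_bundle M)) :
  overlap i j = lsubmx @^-1`
    (chart_map (a := M) i @` (chart_dom (a := M) i `&` chart_dom (a := M) j)).
Proof.
apply/seteqP; split=> [_ [v [iv jv] <-]|z [p [ip jp] pz]].
  by rewrite /preimage /= row_mxKl; exists (base v).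
exists (tangent_at ip (rsubmx z)); first by [].
change (row_mx (chart_map (a := M) i p) (coord (tangent_at ip (rsubmx z)) i) = z).
by rewrite coord_tangent_at pz hsubmxK.
Qed.

Lemma tangent_overlap_open (i j : chart_index (tangent_bundle M)) : open (overlap i j).
Proof.
rewrite tangent_overlapE; apply: open_comp; first by move=> *; exact: continuous_lsubmx.
exact: (chart_overlap_open hM).
Qed.

Lemma tangent_transitionE (i j : chart_index (tangent_bundle M)) z : overlap i j z ->
  transition i j z = row_mx (transition (M := M) i j (lsubmx z))
    ('D_(rsubmx z) (transition (M := M) i j) (lsubmx z)).
Proof.
move=> [v [iv jv] <-]; rewrite (transitionE injT) //= row_mxKl row_mxKr.
by rewrite (transitionE injM) // -(coord_change iv jv).
Qed.

(** [Ck_on] gives continuity in the point for each fixed direction. Expanding the direction in the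
    basis, which is valid over the overlap where the transition is differentiable, yields joint
    continuity. *)
Lemma derive_continuous (i j : chart_index M) (z : 'rV[R]_(mdim M + mdim M)) :
  overlap i j (lsubmx z) ->
  {for z, continuous (fun z => 'D_(rsubmx z) (transition i j) (lsubmx z))}.
Proof.
move=> Bz; have [dt ct] := transition_smooth hM i j 1.
have near_eq : \forall y \near z,
    \sum_a rsubmx y 0 a *: 'D_('e_a) (transition i j) (lsubmx y) =
    'D_(rsubmx y) (transition i j) (lsubmx y).
  have : \forall y \near z, overlap i j (lsubmx y).
    apply: continuous_lsubmx; apply: open_nbhs_nbhs; split=> //.
    exact: (chart_overlap_open hM).
  by apply: filterS => y By; rewrite [RHS]derive_basis //; apply: dt.
suff c : {for z, continuous (fun y : 'rV[R]_(mdim M + mdim M) =>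
    \sum_a rsubmx y 0 a *: 'D_('e_a) (transition i j) (lsubmx y))}.
  rewrite /prop_for /continuous_at -(nbhs_singleton near_eq).
  by apply: cvg_trans c; exact: near_eq_cvg near_eq.
apply: continuous_sum => a; apply: continuousZ.
  apply: (@continuous_comp _ _ _ rsubmx (fun u : 'rV[R]_(mdim M) => u 0 a)).
    exact: continuous_rsubmx.
  exact: coord_continuous.
apply: (@continuous_comp _ _ _ lsubmx ('D_('e_a) (transition i j))).
  exact: continuous_lsubmx.
exact: ct.
Qed.

Lemma tangent_transition_continuous (i j : chart_index (tangent_bundle M)) z :
  overlap i j z -> {for z, continuous (transition i j)}.
Proof.
move=> Bz; have Bl : overlap (i : chart_index M) (j : chart_index M) (lsubmx z).
  by move: Bz; rewrite tangent_overlapE.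
have near_eq : \forall y \near z, row_mx (transition (M := M) i j (lsubmx y))
    ('D_(rsubmx y) (transition (M := M) i j) (lsubmx y)) = transition i j y.
  have : \forall y \near z, overlap i j y.
    by apply: open_nbhs_nbhs; split=> //; exact: tangent_overlap_open.
  by apply: filterS => y /tangent_transitionE ->.
rewrite /prop_for /continuous_at -(nbhs_singleton near_eq).
apply: cvg_trans (near_eq_cvg near_eq) _.
apply: cvg_row_mx; last exact: derive_continuous.
apply: (@continuous_comp _ _ _ lsubmx (transition (M := M) i j)).
  exact: continuous_lsubmx.
exact: (transition_smooth hM i j 0).
Qed.

Lemma chart_preimage_nbhs_tangent (i : chart_index (tangent_bundle M)) (v : tangent_bundle M)
    (V : set 'rV[R]_(mdim (tangent_bundle M))) :
  chart_dom i v -> nbhs (chart_map i v) V ->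
  nbhs v (chart_dom i `&` chart_map i @^-1` V).
Proof.
move=> iv; rewrite nbhsE => -[V' [oV' V'v] V'V].
have oD := chart_preimage_open injT (fun j => @tangent_overlap_open j i)
  (fun j x => @tangent_transition_continuous j i x) oV'.
apply: filterS (open_nbhs_nbhs (conj oD (conj iv V'v))) => w [iw /V'V Vw].
by split.
Qed.

(** [chart_at] may jump between nearby base points, so limits on TM require moving [differential]
    into one fixed chart. *)
Lemma differential_chart (f : M -> R) (v : tangent_vector M) (i : chart_index M) :
  smooth_function f -> chart_dom i (base v) ->
  differential f v = 'D_(coord v i) (f \o chart_inv i) (chart_map i (base v)).
Proof.
move=> fs iv; rewrite /differential.
have jv := chart_atP hM (base v); set j := chart_at _ in jv *.
rewrite (derive_change_chart (g := f) _ iv jv) -?(coord_change iv jv) //.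
by apply: (fs j 1%N).1; exists (base v).
Qed.

End Charts.

(** * Functions with prescribed nonzero derivative *)

Section SeparatingFunctions.
Context {R : realType} (M : atlas R) (hM : smooth_manifold M).
Implicit Types (i j : chart_index M) (p : M).
Local Notation n := (mdim M).
Let injM := chart_map_inj hM.

(** Sums of squares replace the sup norm of rows because they are smooth; positivity singles out the
    open Euclidean ball of radius [rho] around [y]. *)
Definition paraboloid (rho : R) (y x : 'rV[R]_n) : R :=
  rho ^+ 2 - \sum_a (x 0 a - y 0 a) ^+ 2.

Lemma Ck_on_paraboloid (V : normedModType R) k (A : set V) rho y (h : V -> 'rV[R]_n) :
  open A -> Ck_on k A h -> Ck_on k A (paraboloid rho y \o h).
Proof.
move=> oA ch.
have c1 a : Ck_on k A (fun x => h x 0 a - y 0 a).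
  by apply: Ck_onD => //; [exact: Ck_on_coord | exact: Ck_on_cst].
have c2 := Ck_on_sum oA (fun a => Ck_onM oA (c1 a) (c1 a)).
have c3 := Ck_onD oA (Ck_on_cst k A (rho ^+ 2 : R)) (Ck_onM oA (Ck_on_cst k A (-1 : R)) c2).
by apply: Ck_on_eq oA _ c3 => x _; rewrite mulN1r.
Qed.

Lemma derive_paraboloid rho y x w :
  'D_w (paraboloid rho y) x = - \sum_a 2 * (x 0 a - y 0 a) * w 0 a.
Proof.
have dc a : is_derive x w (fun z : 'rV[R]_n => z 0 a - y 0 a) (w 0 a).
  have d1 : is_derive x w (fun z : 'rV[R]_n => z 0 a) (w 0 a).
    apply: DeriveDef.
      by apply: ((derivable_mxP (fun z : 'rV[R]_n => z) x w).1 _ 0 a); exact: derivable_id.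
    have := derive_mx (@derivable_id _ _ x w).
    by rewrite derive_id => /(congr1 (fun A : 'rV[R]_n => A 0 a)); rewrite mxE => ->.
  by apply: is_derive_eq (is_deriveB d1 (is_derive_cst (y 0 a) x w)) _; rewrite subr0.
have ds := is_derive_sum (fun a => is_deriveM (dc a) (dc a)).
have := is_deriveB (is_derive_cst (rho ^+ 2) x w) ds.
rewrite (_ : _ - _ = paraboloid rho y).
  move=> [_ ->]; rewrite sub0r; congr (- _); apply: eq_bigr => a _.
  by rewrite /GRing.scale /=; ring.
apply/funext => z; rewrite /paraboloid !fctE /=; congr (_ - _).
by rewrite fct_sumE; apply: eq_bigr => a _; rewrite expr2.
Qed.

Lemma paraboloid_gt0 rho y x : 0 <= rho -> 0 < paraboloid rho y x -> `|x - y| <= rho.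
Proof.
move=> rho0; rewrite subr_gt0 => lt; apply/mx_norm_leP => // a b.
rewrite ord1 !mxE -(ler_pXn2r (n := 2)) ?nnegrE //.
rewrite real_normK ?num_real //; apply: ltW; apply: le_lt_trans lt.
by rewrite (bigD1 b) //= lerDl sumr_ge0 // => c _; exact: sqr_ge0.
Qed.

Lemma chart_inv_continuous i x : (chart_map i @` chart_dom i) x ->
  {for x, continuous (chart_inv i)}.
Proof.
move=> [p ip <-] A; rewrite chart_mapK // nbhsE => -[B [oB Bp] BA].
have oI := chart_image_open (@chart_codom_open _ _ hM i) oB.
have : nbhs (chart_map i p) (chart_map i @` (B `&` chart_dom i)).
  by apply: open_nbhs_nbhs; split=> //; exists p.
apply: filterS => _ [q [Bq iq] <-]; rewrite /preimage /= chart_mapK //; exact: BA.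
Qed.

Lemma closed_ball_image_closed i x r : 0 < r ->
  closed_ball x r `<=` chart_map i @` chart_dom i ->
  closed (chart_inv i @` closed_ball x r).
Proof.
move=> r0 sub; apply: compact_closed; first exact: manifold_hausdorff.
apply: continuous_compact.
  by apply: continuous_in_subspaceT => z; rewrite inE => /sub; exact: chart_inv_continuous.
apply: bounded_closed_compact; last exact: closed_ball_closed.
exists (`|x| + r); split; first exact: num_real.
move=> N ltN z; rewrite closed_ballE // /closed_ball_ /= => zr.
apply/ltW/(le_lt_trans _ ltN); rewrite -(subrK x z) addrC.
by apply: le_trans (ler_normD _ _) _; rewrite lerD2l distrC.
Qed.

(* flat 0 \o paraboloid is a bump whose center y is shifted from the given point
   against w, so that its derivative there along w is not zero; it extends by 0
   smoothly since its support is compact, hence closed as M is Hausdorff. *)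
Lemma separating_function i p (w : 'rV[R]_n) : chart_dom i p -> w != 0 ->
  exists2 f : M -> R, smooth_function f &
    'D_w (f \o chart_inv i) (chart_map i p) != 0.
Proof.
move=> ip w0; set x0 := chart_map i p.
have [r r0 rI] : exists2 r : R, 0 < r & ball x0 r `<=` chart_map i @` chart_dom i.
  have /nbhs_ballP[r r0 rI] : nbhs x0 (chart_map i @` chart_dom i).
    by apply: open_nbhs_nbhs; split; [exact: chart_codom_open | exists p].
  by exists r.
(* The denominator of [eps] serves two bounds: [eps ^+ 2 * S < rho ^+ 2] puts [x0] inside the bump,
   and [eps * |w| <= rho] keeps the support within 2 [rho] = r/2 of [x0]. *)
pose rho := r / 4; pose S := \sum_a w 0 a ^+ 2.
pose eps := rho / (1 + S + `|w|).
have S0 : 0 < S.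
  rewrite lt_neqAle sumr_ge0 ?andbT; last by move=> *; exact: sqr_ge0.
  apply: contra w0 => /eqP S_eq0; apply/eqP/rowP => a; rewrite mxE.
  have sq0 b : true -> 0 <= w 0 b ^+ 2 by move=> _; exact: sqr_ge0.
  by have /eqP := @psumr_eq0P _ _ _ _ sq0 (esym S_eq0) a isT; rewrite sqrf_eq0 => /eqP.
have rho0 : 0 < rho by rewrite divr_gt0.
have den0 : 0 < 1 + S + `|w| by rewrite ltr_wpDr // ltr_wpDr // ltW.
have eps0 : 0 < eps by rewrite divr_gt0.
have epsE : eps * (1 + S + `|w|) = rho by rewrite divfK // gt_eqF.
pose y := x0 - eps *: w; pose g := paraboloid rho y.
have xy a : x0 0 a - y 0 a = eps * w 0 a by rewrite !mxE; ring.
have gx0 : 0 < g x0.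
  rewrite /g /paraboloid (eq_bigr (fun a => eps ^+ 2 * w 0 a ^+ 2)).
    rewrite -mulr_sumr -/S -epsE exprMn subr_gt0 ltr_pM2l ?exprn_gt0 //.
    by have := normr_ge0 w; nra.
  by move=> a _; rewrite xy exprMn.
have supp x : 0 < g x -> closed_ball x0 (r / 2) x.
  move=> /(paraboloid_gt0 (ltW rho0)) xyr.
  rewrite closed_ballE ?divr_gt0 // /closed_ball_ /=.
  have -> : x0 - x = eps *: w - (x - y).
    by rewrite /y; apply/matrixP => a b; rewrite !mxE; ring.
  apply: le_trans (ler_normB _ _) _; rewrite normrZ (gtr0_norm eps0).
  have : eps * `|w| <= rho.
    rewrite -epsE ler_wpM2l ?(ltW eps0) // lerDr.
    by rewrite addr_ge0 // ltW.
  by rewrite /rho in xyr *; lra.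
pose f (q : M) := if `[< chart_dom i q >] then flat 0 (g (chart_map i q)) else 0.
have fE q : chart_dom i q -> f q = flat 0 (g (chart_map i q)).
  by move=> iq; rewrite /f asboolT.
have subI : closed_ball x0 (r / 2) `<=` chart_map i @` chart_dom i.
  move=> x; rewrite closed_ballE ?divr_gt0 // /closed_ball_ /= => xr; apply: rI.
  by rewrite -ball_normE /ball_ /=; lra.
pose K := chart_inv i @` closed_ball x0 (r / 2).
have cK : closed K by apply: closed_ball_image_closed => //; rewrite divr_gt0.
have f0 q : ~ K q -> f q = 0.
  move=> Kq; rewrite /f; case: asboolP => // iq; apply: flat_le0.
  rewrite leNgt; apply/negP => /supp sq; apply: Kq; exists (chart_map i q) => //.
  exact: chart_mapK.
exists f.
  move=> j k.
  (* Two open sets cover the image of chart [j]: on the overlap with [i] the formula for [f] is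
     smooth, and off the closed set [K] the function is 0. *)
  pose A1 := chart_map j @` (chart_dom j `&` chart_dom i).
  pose A2 := chart_map j @` (~` K `&` chart_dom j).
  have oA1 : open A1 by exact: (chart_overlap_open hM).
  have oA2 : open A2.
    by apply: chart_image_open; [exact: chart_codom_open | exact: closed_openC].
  apply: (@Ck_on_subset _ _ _ _ _ (A1 `|` A2)).
    move=> _ [q jq <-]; have [iq|niq] := pselect (chart_dom i q); first by left; exists q.
    right; exists q => //; split=> // -[x /subI[q' iq' <-]].
    by rewrite chart_mapK // => qq'; apply: niq; rewrite -qq'.
  apply: Ck_on_setU.
    have ctau := transition_smooth hM j i k.
    apply: Ck_on_eq oA1 _ (Ck_on_flat 0 oA1 (Ck_on_paraboloid rho y oA1 ctau)).
    by move=> _ [q [jq iq] <-]; rewrite /comp chart_mapK // fE // transitionE.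
  apply: Ck_on_eq oA2 _ (Ck_on_cst k A2 0).
  by move=> _ [q [Kq jq] <-]; rewrite /comp chart_mapK // f0.
have -> : 'D_w (f \o chart_inv i) x0 = 'D_w (flat 0 \o g) x0.
  apply: near_eq_derive; have := near_overlap hM ip ip.
  by apply: filterS => _ [q [iq _] <-]; rewrite /comp chart_mapK // fE.
have dflat s : differentiable (flat 0 : R -> R) s.
  by apply/derivable1_diffP; have [] := is_derive_flat 0 s.
have dg : differentiable g x0.
  have := @Ck_on_paraboloid _ 1 setT rho y id openT (Ck_on_id _ openT).
  by case=> dg _; apply: dg.
rewrite derive_comp //.
rewrite (derive_realdir _ (dflat (g x0))).
have [_ ->] := is_derive_flat 0 (g x0).
(* The derivative is -2 [eps] [S] times [flat 2 (g x0)], and all three of [eps], [S],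
   [flat 2 (g x0)] are positive. *)
rewrite mul0r subr0; apply: mulf_neq0; last by rewrite gt_eqF // flat_gt0.
rewrite /g derive_paraboloid oppr_eq0.
rewrite (eq_bigr (fun a => 2 * eps * w 0 a ^+ 2)); last by move=> a _; rewrite xy; ring.
rewrite -mulr_sumr -/S; apply: lt0r_neq0.
by apply: mulr_gt0 => //; apply: mulr_gt0 => //; rewrite ltr0n.
Qed.

End SeparatingFunctions.

(** * Complete lifts along the zero section *)

Section VerticalPart.
Context {R : realType} (M : atlas R) (hM : smooth_manifold M).
Local Notation n := (mdim M).
Let injM := chart_map_inj hM.
Let injT := chart_map_inj_tangent hM.

Lemma near_line (V : normedModType R) (B : set V) (z v : V) :
  nbhs z B -> \forall h \near (0 : R)^', B (h *: v + z).
Proof.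
move=> Bz; apply: nbhs_dnbhs.
have : h *: v + z @[h --> (0 : R)] --> 0 *: v + z.
  by apply: cvgD; [apply: cvgZr_tmp; exact: cvg_id | exact: cvg_cst].
by rewrite scale0r add0r => /(_ _ Bz).
Qed.

(* On the zero section the derivative of [f^c] along a vertical vector is the
   derivative of [f]: the difference quotients of (x, v) |-> df_x(v) at (x, 0)
   are df_(x + h xi) (eta). *)
Lemma derive_function_lift_zero (f : M -> R) (i : chart_index (tangent_bundle M))
    (p : M) (z : 'rV[R]_(n + n)) :
  smooth_function f -> chart_dom (i : chart_index M) p ->
  'D_z (function_lift f \o chart_inv i) (chart_map i (zero_vector p)) =
  'D_(rsubmx z) (f \o chart_inv (i : chart_index M)) (chart_map (i : chart_index M) p).
Proof.
move=> fs ip; set x0 := chart_map (i : chart_index M) p.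
set phi := f \o chart_inv (M := M) i.
have z0E : chart_map i (zero_vector p) = row_mx x0 0 by [].
have F0 : (function_lift f \o chart_inv i) (chart_map i (zero_vector p)) = 0.
  rewrite /comp (chart_mapK injT) // /function_lift /differential /=.
  by rewrite derive0.
have cD : {for x0, continuous ('D_(rsubmx z) phi)}.
  by apply: (fs i 1%N).2; exists p.
apply/cvg_lim => //.
have /near_line nl : \forall y \near chart_map i (zero_vector p),
    (chart_map i @` (chart_dom i `&` chart_dom i)) y.
  apply: open_nbhs_nbhs; split; first exact: tangent_overlap_open.
  by exists (zero_vector p).
have cl : h *: lsubmx z + x0 @[h --> (0 : R)^'] --> x0.
  by move=> B Bx; exact: near_line Bx.
apply: cvg_trans (cvg_comp _ _ cl cD); apply: near_eq_cvg; near=> h.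
have h0 : h != 0 by near: h; exact: nbhs_dnbhs_neq.
have [v [iv _] vE] : (chart_map i @` (chart_dom i `&` chart_dom i))
  (h *: z + chart_map i (zero_vector p)) by near: h; exact: nl.
change ('D_(rsubmx z) phi (h *: lsubmx z + x0) =
  h^-1 *: (function_lift f (chart_inv i (h *: z + chart_map i (zero_vector p))) -
  (function_lift f \o chart_inv i) (chart_map i (zero_vector p)))).
rewrite F0 subr0 -vE (chart_mapK injT) // /function_lift (differential_chart hM fs iv).
have := vE; rewrite z0E -[z in h *: z]hsubmxK scale_row_mx add_row_mx addr0.
move=> /eq_row_mx[-> ->].
have dphi : differentiable phi (h *: lsubmx z + x0).
  apply: (fs i 1%N).1; near: h; apply: near_line.
  by apply: open_nbhs_nbhs; split; [exact: chart_codom_open | exists p].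
by rewrite deriveZdir // scalerA mulVf // scale1r.
Unshelve. all: by end_near. Qed.

Lemma complete_lift_spec_vertical0 (X : vector_field M)
    (Y : vector_field (tangent_bundle M)) (p : M) :
  is_complete_lift X Y ->
  rsubmx (coord (Y (zero_vector p)) (chart_at p)) = 0.
Proof.
move=> liftY; apply/eqP/negPn/negP => w0.
have ip := chart_atP hM p; have [f fs /eqP] := separating_function hM ip w0; apply.
have := congr1 (fun F => F (zero_vector p)) (liftY f fs).
(* On the right stands a derivative in the direction 0, which vanishes for any function. *)
rewrite /vf_apply [X in _ = X]/function_lift {2}/differential /= derive0.
by rewrite /differential vf_base /= derive_function_lift_zero.
Qed.

(** Transition maps of TM send (x, 0) to (tau x, 0). A line in a direction without vertical part
    stays in the zero section, so the difference quotients of the transition along it have vertical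
    part 0, and so has their limit. *)
Lemma vertical0_change_chart (i j : chart_index (tangent_bundle M))
    (Y : vector_field (tangent_bundle M)) (p : M) :
  chart_dom (i : chart_index M) p -> chart_dom (j : chart_index M) p ->
  rsubmx (coord (Y (zero_vector p)) i) = 0 -> rsubmx (coord (Y (zero_vector p)) j) = 0.
Proof.
move=> ip jp; set Yp := Y (zero_vector p).
have bY : base Yp = zero_vector p by exact: vf_base.
have iY : chart_dom i (base Yp) by rewrite bY.
have jY : chart_dom j (base Yp) by rewrite bY.
rewrite (coord_change iY jY) bY; set z := coord Yp i => z0.
set x0 := chart_map (i : chart_index M) p.
pose tau := transition (i : chart_index M) j.
suff -> : 'D_z (transition i j) (chart_map i (zero_vector p)) =
    row_mx ('D_(lsubmx z) tau x0) 0 by rewrite row_mxKr.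
apply/cvg_lim => //.
have /near_line nl : \forall y \near chart_map i (zero_vector p),
    (chart_map i @` (chart_dom i `&` chart_dom j)) y.
  apply: open_nbhs_nbhs; split; first exact: tangent_overlap_open.
  by exists (zero_vector p).
have dtau : derivable tau x0 (lsubmx z).
  exact/diff_derivable/transition_differentiable.
apply: cvg_trans (cvg_row_mx dtau (cvg_cst (0 : 'rV[R]_n))); apply: near_eq_cvg; near=> h.
have zB : (chart_map i @` (chart_dom i `&` chart_dom j))
  (h *: z + chart_map i (zero_vector p)) by near: h; exact: nl.
have zE : h *: z + chart_map i (zero_vector p) = row_mx (h *: lsubmx z + x0) 0.
  by rewrite -[z in LHS]hsubmxK z0 scale_row_mx add_row_mx scaler0 addr0.
change (row_mx (h^-1 *: (tau (h *: lsubmx z + x0) - tau x0)) 0 =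
  h^-1 *: (transition i j (h *: z + chart_map i (zero_vector p)) -
           transition i j (chart_map i (zero_vector p)))).
rewrite (tangent_transitionE hM zB) zE row_mxKl row_mxKr derive0.
rewrite (transitionE injT) //= opp_row_mx add_row_mx scale_row_mx subrr scaler0.
by rewrite /tau /x0 (transitionE injM).
Unshelve. all: by end_near. Qed.

Lemma complete_lift_vertical0 (X : vector_field M) (i : chart_index M) (p : M) :
  chart_dom i p ->
  rsubmx (coord (complete_lift X (zero_vector p)) i) = 0.
Proof.
move=> ip; rewrite /complete_lift; case: xgetP => [Y _ /complete_lift_spec_vertical0 Y0|_].
  exact: vertical0_change_chart (chart_atP hM p) ip (Y0 p).
by rewrite /= linear0.
Qed.

End VerticalPart.

(** * Invariance of the zero section *)

Section Gronwall.
Context {R : realType}.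
Local Notation mu := (@lebesgue_measure R).

Lemma is_derive_rsubmx n1 n2 (g : R -> 'rV[R]_(n1 + n2)) (t : R) d :
  is_derive t 1 g d -> is_derive t 1 (rsubmx \o g) (rsubmx d).
Proof.
move=> [dg <-]; have difg : differentiable g t by apply/derivable1_diffP.
have difr : differentiable (@rsubmx R 1 n1 n2) (g t) by exact: differentiable_rsubmx.
apply: DeriveDef; first by apply/diff_derivable/differentiable_comp.
by rewrite derive_comp // deriveE // diff_lin //; exact: continuous_rsubmx.
Qed.

(* If S is the supremum of |y|, the mean value inequality gives S <= K S (b - a). *)
Lemma gronwall_zero (W : normedModType R) (y : R -> W) (a b B K : R) (E : set R) :
  a <= b -> 0 <= K -> K * (b - a) < 1 -> absolutely_continuous a b y -> y a = 0 ->
  (forall t, a <= t <= b -> `|y t| <= B) -> mu.-negligible E ->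
  (forall t, a <= t <= b -> ~ E t ->
     exists2 d, is_derive t 1 y d & `|d| <= K * `|y t|) ->
  y b = 0.
Proof.
move=> ab K0 Kab acy ya yB nE dy.
pose S := [set `|y t| | t in [set t | a <= t <= b]].
have Sb t : a <= t <= b -> S `|y t| by move=> tab; exists t.
(* The a priori bound [B] makes the supremum finite. *)
have hS : has_sup S.
  split; first by exists `|y a|; apply: Sb; rewrite lexx.
  by exists B => _ [t tab <-]; exact: yB.
have leS t : a <= t <= b -> `|y t| <= sup S.
  by move=> /Sb St; apply: sup_upper_bound.
have S0 : 0 <= sup S by apply: le_trans (leS a _) => //; rewrite lexx.
have step t : a <= t <= b -> `|y t| <= K * sup S * (b - a).
  move=> /andP[lat ltb].
  have H : `|y t - y a| <= K * sup S * (t - a).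
    apply: (@ae_mean_value_inequality _ _ y a t (K * sup S) E) => //.
    - exact: mulr_ge0.
    - move=> e e0; have [d d0 acd] := acy e e0; exists d => // k u v uv.
      by apply: acd => i; have [? ? ?] := uv i; split=> //; lra.
    - move=> s /andP[las lst] nEs e e0.
      have sab : a <= s <= b by rewrite las; lra.
      have [d ds dle] := dy s sab nEs.
      have [|r r0 rP] := is_derive_increment ds (C := K * sup S) _ e0.
        by apply: le_trans dle _; rewrite ler_wpM2l // leS.
      by exists r => // s' _; exact: rP.
  move: H; rewrite ya subr0 => /le_trans; apply.
  by rewrite ler_wpM2l ?mulr_ge0 //; lra.
have Sle : sup S <= K * sup S * (b - a).
  by apply: ge_sup => [|_ [t tab <-]]; [case: hS | exact: step].
have S_eq0 : sup S <= 0 by nra.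
apply/eqP; rewrite -normr_le0; apply: le_trans S_eq0; apply: leS.
by rewrite ab lexx.
Qed.

End Gronwall.

Section ZeroSection.
Context {R : realType} (M : atlas R) (hM : smooth_manifold M).
Local Notation n := (mdim M).
Local Notation mu := (@lebesgue_measure R).
Let injM := chart_map_inj hM.
Let injT := chart_map_inj_tangent hM.

(** This is tangency to the zero section: the vertical part is what vanishes there. *)
Definition vertical_on_zero (Z : vector_field (tangent_bundle M)) : Prop :=
  forall (i : chart_index M) (p : M), chart_dom i p ->
    rsubmx (coord (Z (zero_vector p)) i) = 0.

(** Phrased as a property of coordinates [z], so that it can hold near a point of the model space;
    it is vacuous outside the chart image. *)
Definition vertical_bound (Z : vector_field (tangent_bundle M)) (i : chart_index M)
    (K : R) (z : 'rV[R]_(n + n)) : Prop :=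
  forall v : tangent_vector M, chart_dom i (base v) ->
    row_mx (chart_map i (base v)) (coord v i) = z ->
    `|rsubmx (coord (Z v) i)| <= K * `|coord v i|.

(** Compare [v] with the zero vector over the same base point: there the vertical part is 0, the two
    are [|coord v i|] apart in the chart, and the field is locally Lipschitz. *)
Lemma vertical_part_bound (Z : vector_field (tangent_bundle M)) (i : chart_index M) (p : M) :
  vertical_on_zero Z -> chart_dom i p ->
  exists2 K : R, 0 <= K & \forall z \near row_mx (chart_map i p) (0 : 'rV[R]_n),
    vertical_bound Z i K z.
Proof.
move=> Z0 ip; pose iT : chart_index (tangent_bundle M) := i.
pose psi z := coord (Z (chart_inv iT z)) iT.
have oI : open (chart_map iT @` chart_dom iT).
  by rewrite -overlap_refl; exact: tangent_overlap_open.
have z0I : (chart_map iT @` chart_dom iT) (row_mx (chart_map i p) (0 : 'rV[R]_n)).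
  by exists (zero_vector p).
have [r [K [r0 K0 _ lip]]] := C1_locally_lipschitz oI z0I (@vf_smooth _ _ Z iT 1%N).
exists K => //; near=> z => v iv zE.
have zr : ball (row_mx (chart_map i p) 0) r z by near: z; exact: nbhsx_ballx.
(* Dropping the vertical part does not increase the sup-norm distance to the centre, so [z'] remains
   in the ball. *)
pose z' := row_mx (chart_map i (base v)) (0 : 'rV[R]_n).
have z'r : ball (row_mx (chart_map i p) 0) r z'.
  move: zr; rewrite -ball_normE /ball_ /= -zE; apply: le_lt_trans.
  rewrite /z' !opp_row_mx !add_row_mx subr0.
  set A := row_mx _ (0 + _).
  apply: (@row_mx_norm_le R 1 n n); last by rewrite normr0.
  by have := lsubmx_norm_le A; rewrite row_mxKl.
have := lip z z' zr z'r.
have psiz : psi z = coord (Z v) i by rewrite /psi -zE (chart_mapK injT (i := iT) (p := v)).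
have psiz' : rsubmx (psi z') = 0.
  by rewrite /psi (chart_mapK injT (i := iT) (p := zero_vector (base v))) // Z0.
rewrite -[coord (Z v) i]psiz -[rsubmx (psi z)]subr0 -psiz' -linearB.
move=> /(le_trans (rsubmx_norm_le _)) /le_trans; apply.
rewrite ler_wpM2l // -zE /z' opp_row_mx add_row_mx subrr subr0.
by apply: row_mx_norm_le; rewrite ?normr0.
Unshelve. all: by end_near. Qed.

Lemma within_continuous_near (T : topologicalType) (c : R -> T) (a b t : R) (B : set T) :
  {within `[a, b], continuous c} -> a <= t <= b -> nbhs (c t) B ->
  exists2 r : R, 0 < r & forall s, a <= s <= b -> `|s - t| < r -> B (c s).
Proof.
move=> /subspace_continuousP cc tab nB.
have : `[a, b]%classic t by rewrite /= in_itv.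
move=> /cc /(_ B nB) /nbhs_ballP[r /= r0 rP]; exists r => // s sab sr.
by apply: rP; rewrite /= ?in_itv // /ball /= distrC.
Qed.

Lemma tangent_chart_nbhs (i : chart_index M) (v : tangent_bundle M)
    (V : set 'rV[R]_(n + n)) :
  chart_dom i (base v) -> nbhs (row_mx (chart_map i (base v)) (coord v i)) V ->
  nbhs v [set w : tangent_bundle M | chart_dom i (base w) /\
    V (row_mx (chart_map i (base w)) (coord w i))].
Proof. exact: (chart_preimage_nbhs_tangent hM (i := i)). Qed.

Lemma coord_zero_change (i j : chart_index M) (v : tangent_vector M) :
  chart_dom i (base v) -> chart_dom j (base v) -> coord v i = 0 -> coord v j = 0.
Proof. by move=> iv jv vi; rewrite (coord_change iv jv) vi derive0. Qed.

(** Interval induction on being a zero vector. If [c t] is nonzero, so are its neighbours and the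
    step is vacuous; if it is zero, the Gronwall argument in a chart around it carries zero from
    [s1] to [s2]. *)
Lemma zero_section_invariant (m : nat) (X0 : vector_field (tangent_bundle M))
    (X : 'I_m -> vector_field (tangent_bundle M)) (u : R -> 'rV[R]_m) (T Ku : R)
    (c : R -> tangent_bundle M) :
  vertical_on_zero X0 -> (forall k, vertical_on_zero (X k)) ->
  (forall t, 0 <= t <= T -> `|u t| <= Ku) -> 0 <= T ->
  is_solution X0 X u T c ->
  coord (c 0) (chart_at (base (c 0))) = 0 -> coord (c T) (chart_at (base (c T))) = 0.
Proof.
move=> X00 Xk0 uK T0 [c_cont c_ac c_ode].
pose P t := coord (c t) (chart_at (base (c t))) = 0.
move=> P0; apply: (@interval_induction _ P 0 T T0 P0) => t tT.
pose i := chart_at (base (c t)); have it : chart_dom i (base (c t)) by exact: chart_atP.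
have PE s : chart_dom i (base (c s)) -> P s <-> coord (c s) i = 0.
  by move=> is_; split; apply: coord_zero_change => //; exact: chart_atP.
have [Pt|nPt] := pselect (P t); last first.
  have nV : nbhs (row_mx (chart_map i (base (c t))) (coord (c t) i))
      (rsubmx @^-1` (~` [set (0 : 'rV[R]_n)])).
    apply: continuous_rsubmx; rewrite row_mxKr; apply: open_nbhs_nbhs; split.
      exact/closed_openC/accessible_closed_set1/hausdorff_accessible/norm_hausdorff.
    by [].
  have [r r0 rP] := within_continuous_near c_cont tT (tangent_chart_nbhs it nV).
  exists r => // s1 s2 s10 s2T /andP[s1t ts2] rs1 rs2 Ps1; exfalso.
  have [||is1] := rP s1.
  - by rewrite s10 /=; lra.
  - by rewrite ltr_norml; apply/andP; split; lra.
  by rewrite /preimage /= row_mxKr; apply; apply/PE.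
set x := base (c t) in it *.
have ctE : row_mx (chart_map i (base (c t))) (coord (c t) i) = row_mx (chart_map i x) 0.
  by rewrite Pt.
have [K0 K0_ge0 nK0] := vertical_part_bound X00 it.
have /choice[K KP] : forall k, exists K : R, 0 <= K /\
    \forall z \near row_mx (chart_map i x) (0 : 'rV[R]_n), vertical_bound (X k) i K z.
  by move=> k; have [Kk ? ?] := vertical_part_bound (Xk0 k) it; exists Kk.
have nK : \forall z \near row_mx (chart_map i x) (0 : 'rV[R]_n),
    forall k, vertical_bound (X k) i (K k) z.
  have := @filter_forall _ _ (fun k => vertical_bound (X k) i (K k))
    (nbhs (row_mx (chart_map i x) 0)) _.
  by apply => k; case: (KP k).
(* The unit ball provides the a priori bound on the vertical part that [gronwall_zero] asks for. *)
have nB : nbhs (row_mx (chart_map i x) (0 : 'rV[R]_n))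
    (ball (row_mx (chart_map i x) 0) (1 : R)).
  exact: nbhsx_ballx.
have nV : nbhs (row_mx (chart_map i (base (c t))) (coord (c t) i))
    (ball (row_mx (chart_map i x) (0 : 'rV[R]_n)) (1 : R) `&`
     (vertical_bound X0 i K0 `&` [set z | forall k, vertical_bound (X k) i (K k) z])).
  by rewrite ctE; apply: filterI nB _; exact: filterI nK0 nK.
have [r r0 rP] := within_continuous_near c_cont tT (tangent_chart_nbhs (v := c t) it nV).
have Ku0 : 0 <= Ku by apply: le_trans (uK t tT).
pose L := K0 + \sum_k Ku * K k.
have L0 : 0 <= L.
  by rewrite addr_ge0 // sumr_ge0 // => k _; rewrite mulr_ge0 // (KP k).1.
have L1 : 0 < 2 * (L + 1) by rewrite mulr_gt0 // ltr_wpDl.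
(* Then [s2 - s1] is below 1 / (L + 1), so [L * (s2 - s1) < 1]; adding 1 to [L] covers [L = 0]. *)
exists (Num.min r (2 * (L + 1))^-1); first by rewrite lt_min r0 invr_gt0.
move=> s1 s2 s10 s2T /andP[s1t ts2] rs1 rs2 Ps1.
have [rs1r rs2r] : t - r < s1 /\ s2 < t + r.
  by move: rs1 rs2; rewrite /Num.min; case: ifP => h; lra.
have s12L : L * (s2 - s1) < 1.
  have : s2 - s1 < 2 * (2 * (L + 1))^-1.
    by move: rs1 rs2; rewrite /Num.min; case: ifP => h; lra.
  rewrite invfM mulrA mulfV // mul1r => h.
  have : (s2 - s1) * (L + 1) < 1 by rewrite -ltr_pdivlMr ?mul1r // ltr_wpDl.
  lra.
have near_t s : s1 <= s <= s2 -> 0 <= s <= T /\ `|s - t| < r.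
  move=> /andP[? ?]; split; first by apply/andP; split; lra.
  by rewrite ltr_norml; apply/andP; split; lra.
have cV s : s1 <= s <= s2 -> [/\ chart_dom i (base (c s)), `|coord (c s) i| <= 1,
    `|rsubmx (coord (X0 (c s)) i)| <= K0 * `|coord (c s) i| &
    forall k, `|rsubmx (coord (X k (c s)) i)| <= K k * `|coord (c s) i|].
  move=> /near_t[sT sr]; have [is_ [Bs [K0s Ks]]] := rP s sT sr.
  split=> //; [|exact: K0s|by move=> k; exact: Ks].
  move: Bs; rewrite -ball_normE /ball_ /= => /ltW; apply: le_trans.
  set A := row_mx _ _ - _; have := rsubmx_norm_le A.
  by rewrite /A linearB /= !row_mxKr sub0r normrN.
have s12 : s1 <= s2 := le_trans s1t ts2.
have [|is1 _ _ _] := cV s1; rewrite ?lexx //.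
have [|is2 _ _ _] := cV s2; rewrite ?lexx ?andbT //.
apply/(PE _ is2).
pose y s := coord (c s) i.
pose g (s : R) := chart_map (i : chart_index (tangent_bundle M)) (c s).
have yE : y = rsubmx \o g by apply/funext => s; rewrite /g /= row_mxKr.
(* The endpoints join the exceptional set because the differential equation is asserted only for
   [0 < s < T]. *)
pose E := ~` [set s | 0 < s < T -> forall j : chart_index (tangent_bundle M),
  chart_dom j (c s) -> is_derive s 1 (chart_map j \o c)
   (coord (X0 (c s)) j + \sum_(k < m) u s 0 k *: coord (X k (c s)) j)] `|` [set 0; T].
apply: (@gronwall_zero _ _ y s1 s2 1 L E) => //.
- move=> e e0.
  have [||s /cV[]|d d0 acd] := c_ac (i : chart_index (tangent_bundle M)) s1 s2 _ _ _ e e0 => //.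
  exists d => // k a b ab tI sd; apply: le_lt_trans (acd k a b ab tI sd).
  apply: ler_sum => l _; rewrite yE /= -linearB; exact: rsubmx_norm_le.
- exact/(PE _ is1).
- by move=> s /cV[].
- apply: negligibleU; first exact: c_ode.
  by apply: negligibleU; apply/negligibleP => //; exact: lebesgue_measure_set1.
move=> s s12s nE.
have [sT _] := near_t s s12s; have [is_ _ X0s Xs] := cV s s12s.
have s_in : 0 < s < T.
  move: nE => /not_orP[_ nE]; rewrite !lt_neqAle; case/andP: sT => -> ->; rewrite !andbT.
  by apply/andP; split; apply/eqP => sE; apply: nE; [left|right].
have ds : is_derive s 1 g (coord (X0 (c s)) i + \sum_(k < m) u s 0 k *: coord (X k (c s)) i).
  by move: nE => /not_orP[/contrapT nE _]; exact: (nE s_in i).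
exists (rsubmx (coord (X0 (c s)) i + \sum_(k < m) u s 0 k *: coord (X k (c s)) i)).
  by rewrite yE; exact: is_derive_rsubmx.
rewrite linearD linear_sum mulrDl; apply: le_trans (ler_normD _ _) _.
apply: lerD => //; apply: le_trans (ler_norm_sum _ _ _) _.
rewrite mulr_suml; apply: ler_sum => k _; rewrite linearZ normrZ -mulrA.
apply: ler_pM => //; last exact: Xs.
by apply: le_trans (uK s sT); apply: (mx_norm_leP (u s) _).1.
Qed.

End ZeroSection.

Theorem theorem3p2 (R : realType) (M : atlas R) (hM : smooth_manifold M)
  (hdim : (0 < mdim M)%N) (m : nat) (U : set 'rV[R]_m)
  (adm : set (R -> 'rV[R]_m)) (hadm : control_class U adm)
  (X0 : vector_field M) (X : 'I_m -> vector_field M) :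
  ~ controllable adm (complete_lift X0) (fun i => complete_lift (X i)).
Proof.
pose p := origin M; have ip := chart_atP hM p.
(* A row of ones is nonzero exactly because the dimension is positive. *)
pose w := const_mx 1 : 'rV[R]_(mdim M).
move=> /(_ (zero_vector p) (tangent_at hM ip w))[T [u [c [T0 adm_u sol c0 cT]]]].
have [_ _ /(_ 0 T)[Ku uK]] := hadm _ adm_u.
have lift0 (Y : vector_field M) : vertical_on_zero (complete_lift Y).
  by move=> i q; exact: (complete_lift_vertical0 hM).
have := zero_section_invariant hM (lift0 X0) (fun k => lift0 (X k)) uK (ltW T0) sol.
rewrite c0 cT => /(_ erefl); rewrite [chart_at _]/(chart_at p) coord_tangent_at //.
by move=> /rowP /(_ (Ordinal hdim)) /eqP; rewrite !mxE oner_eq0.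
Qed.
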